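(* Let $a\in\mathbb{R}$ and let $w$ be the constant graphon $w(x,y)=a$ for all $x,y\in I=[0,1]$. Assume that for every $\boldsymbol{\alpha}\in\mathbb{A}$ there is a unique $\mathbf{z}\in L^2(I)$ with $z_x=\int_I w(x,y)b(\alpha_y,z_y)\,dy$ for a.e. $x\in I$ (so that $\mathbf{Z}$ is well defined), and that for every $\boldsymbol{\alpha}\in\mathbb{A}$ and a.e. $x\in I$ the map $A\ni\alpha\mapsto\mathcal{J}(\alpha,[\mathbf{Z}\boldsymbol{\alpha}]_x)$ has a unique minimizer. (1) If $\hat{\boldsymbol{\alpha}}\in\mathbb{A}$ is a Nash equilibrium for the graphon game with graphon $w$, then $\hat\alpha_x$ is constant for a.e. $x\in I$, and its constant value $\hat\alpha$ is a Nash equilibrium for the mean field game with constant $a$. (2) Conversely, if $\hat\alpha\in A$ is a Nash equilibrium for the mean field game with constant $a$, then $\hat{\boldsymbol{\alpha}}\in L^2(I)$ defined by $\hat\alpha_x=\hat\alpha$ for every $x\in I$ is a Nash equilibrium for the graphon game with graphon $w$.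
   Context: $I=[0,1]$ with Lebesgue measure; $L^2(I)$ is the usual real Lebesgue space. $A\subset\mathbb{R}$ is a nonempty closed convex set of actions, and $\mathbb{A}$ is the set of $\boldsymbol{\alpha}\in L^2(I)$ with values in $A$ (admissible strategy profiles). $\mu_0$ is a mean-zero probability measure on $\mathbb{R}$ with finite second moment, $\xi_0\sim\mu_0$; $b:A\times\mathbb{R}\to\mathbb{R}$ and $f:\mathbb{R}\times A\times\mathbb{R}\to\mathbb{R}$ are given functions, and $\mathcal{J}(\alpha,z)=\mathbb{E}[f(b(\alpha,z)+\xi_0,\alpha,z)]$ for $(\alpha,z)\in A\times\mathbb{R}$ (assumed well defined). Graphon game: a graphon is a symmetric Borel measurable square-integrable function $w:I\times I\to\mathbb{R}$. For $\boldsymbol{\alpha}\in\mathbb{A}$, $\mathbf{Z}\boldsymbol{\alpha}$ denotes the unique $\mathbf{z}\in L^2(I)$ with $z_x=\int_I w(x,y)b(\alpha_y,z_y)\,dy$ for a.e. $x$. A player $x$ using action $\alpha\in A$ while the others use $\boldsymbol{\alpha}$ incurs cost $\mathcal{J}(\alpha,[\mathbf{Z}\boldsymbol{\alpha}]_x)$. A Nash equilibrium for the graphon game is $\hat{\boldsymbol{\alpha}}\in\mathbb{A}$ such that for a.e. $x\in I$, $\mathcal{J}(\hat\alpha_x,[\mathbf{Z}\hat{\boldsymbol{\alpha}}]_x)\le\mathcal{J}(\beta,[\mathbf{Z}\hat{\boldsymbol{\alpha}}]_x)$ for all $\beta\in A$. Mean field game (MFG) with constant $a$: $\hat\alpha\in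 A$ is a Nash equilibrium if $\mathcal{J}(\hat\alpha,\hat z)\le\mathcal{J}(\beta,\hat z)$ for all $\beta\in A$, where $\hat z\in\mathbb{R}$ is the unique solution of $\hat z=a\,\mathbb{E}[b(\hat\alpha,\hat z)+\xi_0]$. *)

(* Defs.v *)
From HB Require Import structures.
From mathcomp Require Import all_boot all_order all_algebra.
From mathcomp Require Import all_classical all_reals all_analysis.

Set Implicit Arguments.
Unset Strict Implicit.
Unset Printing Implicit Defensive.

Import Order.TTheory GRing.Theory Num.Theory.
Import numFieldNormedType.Exports.

Local Open Scope classical_set_scope.
Local Open Scope ring_scope.

Definition unitI {R : realType} : set R := `[0, 1].

Local Notation mu := lebesgue_measure.

(* Representatives of elements of L^2(I): Borel functions R -> R of which only
   the restriction to I matters.  Elements of L^2(I) are equal when their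
   representatives are equal mu-almost everywhere in I. *)
Definition L2I {R : realType} : set (R -> R) :=
  [set g | g \_ unitI \in Lfun (@lebesgue_measure R) 2%:E].

Definition is_graphon {R : realType} (w : R -> R -> R) : Prop :=
  {in unitI &, forall x y, w x y = w y x} /\
  (fun p : measurableTypeR R * measurableTypeR R => w p.1 p.2)
     \_ (unitI `*` unitI)
    \in Lfun ((@lebesgue_measure R) \x (@lebesgue_measure R))%E 2%:E.

(* The representative is taken to be A-valued everywhere on I, so that the
   values of b, f and the cost outside of A never intervene. *)
Definition admissible {R : realType} (A : set R) : set (R -> R) :=
  [set alpha | L2I alpha /\ forall x, unitI x -> A (alpha x)].

(* Integrability is required since the integral of a nonintegrable function is
   a default value in the library. *)
Definition state_eq {R : realType} (b w : R -> R -> R) (alpha z : R -> R)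
    : Prop :=
  L2I z /\
  {ae mu, forall x, unitI x ->
    mu.-integrable unitI (fun y => (w x y * b (alpha y) (z y))%:E) /\
    ((z x)%:E = \int[mu]_(y in unitI) (w x y * b (alpha y) (z y))%:E)%E}.

Definition state_eq_wellposed {R : realType} (A : set R) (b w : R -> R -> R)
    : Prop :=
  forall alpha, admissible A alpha ->
    exists2 z, state_eq b w alpha z &
      forall z', state_eq b w alpha z' -> (z' = z %[ae mu in unitI]).

(* A representative of the solution, meaningful under state_eq_wellposed *)
Definition Zop {R : realType} (b w : R -> R -> R) (alpha : R -> R) : R -> R :=
  xget (cst 0) [set z | state_eq b w alpha z].

Definition cost {d} {T : measurableType d} {R : realType}
    (P : probability T R) (xi0 : T -> R) (b : R -> R -> R)
    (f : R -> R -> R -> R) (alpha z : R) : \bar R :=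
  'E_P[(fun t => f (b alpha z + xi0 t) alpha z)%R]%E.

(* X has an expectation in [-oo, +oo]; in particular X may be integrable. *)
Definition has_expectation {d} {T : measurableType d} {R : realType}
    (P : probability T R) (X : T -> R) : Prop :=
  measurable_fun setT X /\
  ('E_P[(fun t => Num.max (X t) 0)%R] < +oo \/
   'E_P[(fun t => Num.max (- X t) 0)%R] < +oo)%E.

Definition minimizer {R : realType} (A : set R) (h : R -> \bar R) (alpha : R)
    : Prop :=
  A alpha /\ forall beta, A beta -> (h alpha <= h beta)%E.

Definition graphon_nash {R : realType} (A : set R) (b w : R -> R -> R)
    (J : R -> R -> \bar R) (alpha : R -> R) : Prop :=
  admissible A alpha /\
  {ae mu, forall x, unitI x -> forall beta, A beta ->
    (J (alpha x) (Zop b w alpha x) <= J beta (Zop b w alpha x))%E}.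

Definition mfg_state_eq {d} {T : measurableType d} {R : realType}
    (P : probability T R) (xi0 : T -> R) (b : R -> R -> R) (a alpha z : R)
    : Prop :=
  (z%:E = a%:E * 'E_P[(fun t => b alpha z + xi0 t)%R])%E.

Definition mfg_nash {d} {T : measurableType d} {R : realType}
    (P : probability T R) (xi0 : T -> R) (A : set R) (b : R -> R -> R)
    (J : R -> R -> \bar R) (a alpha : R) : Prop :=
  A alpha /\
  exists z, [/\ mfg_state_eq P xi0 b a alpha z,
    forall z', mfg_state_eq P xi0 b a alpha z' -> z' = z &
    forall beta, A beta -> (J alpha z <= J beta z)%E].

(* Main.v *)
Require Import Defs.
From HB Require Import structures.
From mathcomp Require Import all_boot all_order all_algebra.
From mathcomp Require Import all_classical all_reals all_analysis.
From mathcomp Require Import measurable_realfun.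

Import Order.TTheory GRing.Theory Num.Theory.
Import numFieldNormedType.Exports.

Local Open Scope classical_set_scope.
Local Open Scope ring_scope.

(** When the graphon is a constant [a], the right-hand side of the state
    equation does not depend on [x], so every state is almost everywhere equal
    to a number [c] ([state_eq_ae_cst]).  All players but a null set then face
    the same cost [J(., c)], whose minimizer is unique, so an equilibrium
    profile is almost everywhere a constant [ahat].  For constant profile and
    state the integral equation, posed on an interval of measure 1, reduces to
    the scalar equation [c = a * b ahat c] ([state_eq_ae_cst_fixpoint] and its
    converse [state_eq_cst]).

    The mean field equation [z = a * E[b ahat z + xi0]] is that same scalar
    equation, because [xi0] has mean zero ([mfg_state_eqE]).  Hence constant
    states of the graphon game and states of the mean field game correspond to
    each other; uniqueness of the mean field state comes from uniqueness of the
    graphon state applied to constant functions, which agree almost everywhere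
    on the unit interval only if they are equal. *)

(** Lebesgue measure lives on the generated sigma-algebra of a type convertible
    to [R]; naming the instance lets filter lemmas find it through that
    conversion. *)
#[local] Instance lebesgue_ae_filter (R : realType) :
  Filter (almost_everywhere (@lebesgue_measure R)) :=
  ae_filter_ringOfSetsType _.

Section unit_interval.
Context {R : realType}.
Implicit Types (Q : R -> Prop) (c k : R).
Local Notation mu := (@lebesgue_measure R).

Lemma lebesgue_measure_unitI : mu unitI = 1%E.
Proof. by rewrite /unitI lebesgue_measure_itv/= lte_fin ltr01 oppr0 adde0. Qed.

Lemma measurable_unitI : measurable (unitI : set (measurableTypeR R)).
Proof. exact: measurable_itv. Qed.

(** Turns an almost-everywhere statement into one about numbers: when [Q] does
    not depend on its argument, the conclusion is [Q] itself. *)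
Lemma ae_unitI_ex Q :
  {ae mu, forall x, unitI x -> Q x} -> exists2 x, unitI x & Q x.
Proof.
move=> aeQ; apply: contrapT => nQ.
have negI : mu.-negligible unitI.
  apply: negligibleS aeQ => x Ix /= QIx.
  by apply: nQ; exists x => //; exact: QIx.
have /eqP : (1 = 0 :> \bar R)%E.
  rewrite -lebesgue_measure_unitI.
  exact: measure_negligible measurable_unitI negI.
by rewrite onee_eq0.
Qed.

Lemma integral_unitI_cst k : (\int[mu]_(y in unitI) k%:E = k%:E)%E.
Proof.
rewrite -[RHS]mule1 -lebesgue_measure_unitI.
exact: integral_cst measurable_unitI _.
Qed.

Lemma integrable_unitI_cst k : mu.-integrable unitI (fun=> k%:E).
Proof.
apply/integrableP; split; first exact: measurable_cst.
by rewrite integral_unitI_cst ltry.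
Qed.

Lemma L2I_cst c : L2I (cst c : R -> R).
Proof.
have mc : measurable_fun setT ((cst c : R -> R) \_ unitI).
  by apply/(measurable_restrictT _ measurable_unitI); exact: measurable_cst.
rewrite /L2I/= inE; apply/andP; split; rewrite inE//=.
rewrite /finite_norm unlock poweR_lty//.
rewrite (_ : (fun _ => _) = (fun=> (`|c| `^ 2)%:E) \_ unitI); last first.
  apply/funext => x; rewrite /= !patchE; case: ifPn => // _.
  (* Outside of [unitI] the restriction takes the default value, 0 in [R]. *)
  by rewrite (_ : point = 0)// normr0 powR0.
rewrite (le_lt_trans _ (ltry (`|c| `^ 2)))// -[leRHS]integral_unitI_cst.
by rewrite [leRHS]integral_mkcond.
Qed.

End unit_interval.

Section constant_graphon.
Context {R : realType}.
Variables (b w : R -> R -> R) (a : R).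
Hypothesis w_cst : forall x y, unitI x -> unitI y -> w x y = a.
Implicit Types (alpha z : R -> R) (c ahat : R).
Local Notation mu := (@lebesgue_measure R).

Lemma Zop_state_eq (A : set R) alpha :
  state_eq_wellposed A b w -> admissible A alpha ->
  state_eq b w alpha (Zop b w alpha).
Proof. by move=> wd /wd[z zs _]; apply: xgetPex; exists z. Qed.

Lemma integral_cst_graphon alpha z x : unitI x ->
  (\int[mu]_(y in unitI) (w x y * b (alpha y) (z y))%:E =
   \int[mu]_(y in unitI) (a * b (alpha y) (z y))%:E)%E.
Proof.
by move=> Ix; apply: eq_integral => y; rewrite inE => Iy; rewrite w_cst.
Qed.

Lemma state_eq_ae_cst alpha z : state_eq b w alpha z ->
  exists c, {ae mu, forall x, unitI x -> z x = c}.
Proof.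
move=> [_ zE].
exists (fine (\int[mu]_(y in unitI) (a * b (alpha y) (z y))%:E)%E).
apply: filterS zE => x zE Ix; have [_] := zE Ix.
by rewrite integral_cst_graphon// => <-.
Qed.

(** The integrability built into the state equation supplies the measurability
    that allows replacing [alpha] and [z] under the integral by the constants
    they equal almost everywhere. *)
Lemma state_eq_ae_cst_fixpoint alpha z ahat c : state_eq b w alpha z ->
  {ae mu, forall x, unitI x -> alpha x = ahat} ->
  {ae mu, forall x, unitI x -> z x = c} ->
  c = a * b ahat c.
Proof.
move=> [_ zE] aE cE.
have [x Ix [zx [int_x intE]]] : exists2 x, unitI x &
    z x = c /\ mu.-integrable unitI (fun y => (w x y * b (alpha y) (z y))%:E) /\
    ((z x)%:E = \int[mu]_(y in unitI) (w x y * b (alpha y) (z y))%:E)%E.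
  apply: ae_unitI_ex; apply: filterS2 zE cE => x zE cE Ix.
  by split; [exact: cE | exact: zE].
apply: EFin_inj; rewrite -{1}zx intE -[RHS]integral_unitI_cst.
apply: ae_eq_integral => //; first exact: measurable_unitI.
- exact: measurable_int int_x.
- apply: filterS2 aE cE => y aE cE Iy /=.
  by rewrite w_cst// aE// cE.
Qed.

(** Supplies the constant candidates to which well-posedness of the graphon
    state equation is applied. *)
Lemma state_eq_cst ahat c :
  c = a * b ahat c -> state_eq b w (cst ahat) (cst c).
Proof.
move=> cE; split; first exact: L2I_cst.
apply: aeW => x Ix; split; last first.
  rewrite (integral_cst_graphon (cst ahat) (cst c))//= -cE.
  by rewrite integral_unitI_cst.
apply: eq_integrable (integrable_unitI_cst c); first exact: measurable_unitI.
by move=> y; rewrite inE => Iy; rewrite w_cst//= -cE.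
Qed.

End constant_graphon.

Section centered_noise.
Context {d} {T : measurableType d} {R : realType} (P : probability T R).

(** A real variable is integrable as soon as its law has a finite second moment
    because [|x| <= 1 + x^2]. *)
Lemma expectation_cstD_centered (mu0 : probability (measurableTypeR R) R)
    (xi0 : {RV P >-> measurableTypeR R}) :
  (\int[mu0]_x (x ^+ 2)%:E < +oo)%E -> (\int[mu0]_x x%:E = 0)%E ->
  (forall B : set (measurableTypeR R), measurable B ->
    distribution P xi0 B = mu0 B) ->
  forall k : R, ('E_P[(fun t => k + xi0 t)%R] = k%:E)%E.
Proof.
move=> m2 m1 law k.
have mu0E (g : measurableTypeR R -> \bar R) :
    (\int[mu0]_x g x = \int[distribution P xi0]_x g x)%E.
  by apply: eq_measure_integral => B mB _; exact/esym/law.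
have mxi : measurable_fun setT (xi0 : T -> R) by exact: (measurable_funP xi0).
have sq_int : P.-integrable setT (fun t => (xi0 t ^+ 2)%:E).
  apply/integrableP; split.
    by apply/measurable_EFinP; exact: measurable_funX.
  apply: le_lt_trans m2; rewrite mu0E ge0_integral_distribution; last 2 first.
  - by apply/measurable_EFinP; exact: measurable_funX.
  - by move=> y; rewrite lee_fin sqr_ge0.
  rewrite le_eqVlt; apply/orP; left; apply/eqP.
  by apply: eq_integral => t _ /=; rewrite ger0_norm ?sqr_ge0.
have xi_int : P.-integrable setT (EFin \o (xi0 : T -> R)).
  apply: (@le_integrable _ _ _ P _ measurableT _
      (fun t => 1%:E + (xi0 t ^+ 2)%:E)%E) => //.
  - exact/measurable_EFinP.
  - move=> t _; rewrite -EFinD !abse_EFin lee_fin.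
    rewrite [leRHS]ger0_norm ?addr_ge0 ?sqr_ge0// -real_normK ?num_real//.
    have [n1|/ltW n1] := leP `|xi0 t| 1.
      by rewrite (le_trans n1)// lerDl sqr_ge0.
    by rewrite (le_trans (_ : _ <= `|xi0 t| ^+ 2))// ?ler_eXnr// lerDr.
  - apply: integrableD => //; apply/Lfun1_integrable.
    exact: Lfun_cst.
have xi_mean : ('E_P[xi0] = 0)%E.
  rewrite unlock -m1 mu0E.
  by rewrite integral_distribution//; exact/measurable_EFinP.
have -> : (fun t => k + xi0 t) = cst k \+ xi0 by [].
rewrite expectationD ?Lfun_cst//; last exact/Lfun1_integrable.
by rewrite expectation_cst xi_mean adde0.
Qed.

(** The noise enters the mean field equation only through its mean. *)
Lemma mfg_state_eqE (xi0 : T -> R) (b : R -> R -> R) (a ahat z : R) :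
  (forall k : R, 'E_P[(fun t => k + xi0 t)%R] = k%:E)%E ->
  mfg_state_eq P xi0 b a ahat z <-> z = a * b ahat z.
Proof.
move=> meanE; rewrite /mfg_state_eq meanE -EFinM.
by split=> [zE|<-//]; exact: EFin_inj.
Qed.

End centered_noise.

Theorem proposition3p9 (R : realType)
  (A : set R) (A_nonempty : A !=set0) (A_closed : closed A)
  (A_convex : convex_set (A : set (convex_lmodType R^o)))
  (mu0 : probability (measurableTypeR R) R)
  (mu0_moment2 : (\int[mu0]_x (x ^+ 2)%:E < +oo)%E)
  (mu0_mean : (\int[mu0]_x x%:E = 0)%E)
  (d : measure_display) (T : measurableType d) (P : probability T R)
  (xi0 : {RV P >-> measurableTypeR R})
  (xi0_law : forall B : set (measurableTypeR R), measurable B ->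
    distribution P xi0 B = mu0 B)
  (b : R -> R -> R) (f : R -> R -> R -> R)
  (cost_wd : forall alpha z, A alpha ->
    has_expectation P (fun t => f (b alpha z + xi0 t) alpha z))
  (a : R) (w : R -> R -> R) (w_graphon : is_graphon w)
  (w_cst : forall x y, unitI x -> unitI y -> w x y = a)
  (Z_wd : state_eq_wellposed A b w)
  (unique_min : forall alpha, admissible A alpha ->
    {ae lebesgue_measure, forall x, unitI x ->
      exists! beta,
        minimizer A (fun c => cost P xi0 b f c (Zop b w alpha x)) beta}) :
  (forall alpha, graphon_nash A b w (cost P xi0 b f) alpha ->
    exists2 ahat : R,
      {ae lebesgue_measure, forall x, unitI x -> alpha x = ahat} &
      mfg_nash P xi0 A b (cost P xi0 b f) a ahat) /\
  (forall ahat : R, mfg_nash P xi0 A b (cost P xi0 b f) a ahat ->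
    graphon_nash A b w (cost P xi0 b f) (cst ahat)).
Proof.
have meanE := expectation_cstD_centered P mu0 xi0 mu0_moment2 mu0_mean xi0_law.
have admissible_cst ahat : A ahat -> admissible A (cst ahat).
  by move=> Aahat; split=> //; exact: L2I_cst.
have mfgE := fun ahat z => mfg_state_eqE P xi0 b a ahat z meanE.
split.
- move=> alpha [alphaA nash].
  have Zs := Zop_state_eq b w A alpha Z_wd alphaA.
  have [c cE] := state_eq_ae_cst b w a w_cst alpha _ Zs.
  have alpha_min : {ae lebesgue_measure, forall x, unitI x ->
      minimizer A (fun k => cost P xi0 b f k c) (alpha x)}.
    apply: filterS2 nash cE => x nash cE Ix; rewrite -(cE Ix).
    by split; [exact: alphaA.2 | exact: nash].
  (* The unique minimizer is read off at a single player whose state is [c]: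
     it is the same for all players in this situation. *)
  have [ahat ahat_uniq] : exists ahat,
      forall k, minimizer A (fun k => cost P xi0 b f k c) k -> ahat = k.
    have [x Ix [ahat [_ ahat_uniq]]] : exists2 x : R, unitI x &
        exists! beta, minimizer A (fun k => cost P xi0 b f k c) beta.
      apply: ae_unitI_ex; apply: filterS2 (unique_min _ alphaA) cE.
      by move=> x um cE Ix; rewrite -(cE Ix); exact: um.
    by exists ahat.
  have alphaE : {ae lebesgue_measure, forall x, unitI x -> alpha x = ahat}.
    by apply: filterS alpha_min => x am Ix; rewrite (ahat_uniq _ (am Ix)).
  have [x Ix [min_x ax]] : exists2 x, unitI x &
      minimizer A (fun k => cost P xi0 b f k c) (alpha x) /\ alpha x = ahat.
    apply: ae_unitI_ex; apply: filterS2 alpha_min alphaE => x am aE Ix.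
    by split; [exact: am | exact: aE].
  rewrite ax in min_x.
  have c_fix := state_eq_ae_cst_fixpoint b w a w_cst _ _ _ _ Zs alphaE cE.
  exists ahat => //; split; first exact: min_x.1.
  exists c; split; [exact/mfgE | | exact: min_x.2].
  move=> z' /mfgE z'_fix.
  have [z _ z_uniq] := Z_wd _ (admissible_cst _ min_x.1).
  have zc := z_uniq _ (state_eq_cst _ _ _ w_cst _ _ c_fix).
  have zz' := z_uniq _ (state_eq_cst _ _ _ w_cst _ _ z'_fix).
  (* Both [cst c] and [cst z'] solve the state equation of [cst ahat]. *)
  have [y _ //] : exists2 y : R, unitI y & z' = c.
  apply: ae_unitI_ex; apply: filterS2 zc zz' => y zc zz' Iy.
  exact: etrans (zz' Iy) (esym (zc Iy)).
- move=> ahat [Aahat [z [/mfgE z_fix _ z_min]]].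
  have adm := admissible_cst _ Aahat.
  split=> //.
  have [z0 _ z0_uniq] := Z_wd _ adm.
  have zz0 := z0_uniq _ (state_eq_cst _ _ _ w_cst _ _ z_fix).
  have Zz0 := z0_uniq _ (Zop_state_eq _ _ _ _ Z_wd adm).
  apply: filterS2 zz0 Zz0 => x zz0 Zz0 Ix beta Abeta.
  by rewrite (Zz0 Ix) -(zz0 Ix); exact: z_min.
Qed.
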